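(* Let $n\ge2$, $[n]=\{1,\dots,n\}$. For each $j\in[n]$ let $X_j$ be an inf-semilattice and $S_j$ a nonempty comprehensive subset of $X_j$ having an upper bound in $X_j$. For all $k,j\in[n]$ let $u_{k,j}:X_j\to\Lambda$ be quasi-Leontief, let $u_k(x)=\min_{j\in[n]}u_{k,j}(x_j)$ and $\tilde u_k(x_{-k})=\min_{j\ne k}u_{k,j}(x_j)$. Let $i\in[n]$ and let $x^\star$ be a Nash point of the game $(u_k,S_k,X_k)_{k\in[n]}$ such that $\tilde u_i(x^\star_{-i})\ge u_{i,i}(x_i^\star)$. Then $x^\star$ is efficient for player $i$ if and only if $x_i^\star\in\mathcal{E}(u_{i,i};S_i)$. Moreover $u_i(x^\star)=u_{i,i}(x_i^\star)$.
   Context: $\Lambda$ is a totally ordered set. An inf-semilattice is a partially ordered set in which every two elements have a greatest lower bound. A subset $S$ of a partially ordered set $X$ is comprehensive if $x\in S$, $y\in X$, $y\le x$ imply $y\in S$. A function $u:X\to\Lambda$ on a partially ordered set is quasi-Leontief if for every $x\in X$ the set $\{x'\in X:u(x')\ge u(x)\}$ equals $\{x'\in X:x'\ge a\}$ for some $a\in X$. For a function $u$ defined on $S$, the set of efficient points is $\mathcal{E}(u;S)=\{x\in S:\forall x'\in S,\ u(x')\ge u(x)\Rightarrow x'\ge x\}$. A Nash point is $x^\star\in\prod_jS_j$ such that for all $k$ and all $x_k\in S_k$, $u_k(x^\star)\ge u_k(x^\star_{-k};x_k)$, where $x^\star_{-k}=(x_j^\star)_{j\ne k}$ and $(x^\star_{-k};x_k)$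 is $x^\star$ with the $k$-th coordinate replaced by $x_k$. A Nash point $x^\star$ is efficient for player $i$ if $x_i^\star\in\mathcal{E}(u_i[x^\star_{-i}]_{|S_i};S_i)$, i.e. for all $x_i\in S_i$, $u_i(x^\star_{-i};x_i)\ge u_i(x^\star)$ implies $x_i\ge x_i^\star$. *)

(* Defs.v *)
From mathcomp Require Import all_boot all_order.
From mathcomp Require Import classical_sets.

Set Implicit Arguments.
Unset Strict Implicit.
Unset Printing Implicit Defensive.

Local Open Scope classical_set_scope.
Local Open Scope order_scope.

Definition comprehensive d (X : porderType d) (S : set X) : Prop :=
  forall x y : X, S x -> y <= x -> S y.

Definition quasi_leontief d d' (X : porderType d) (L : orderType d')
    (u : X -> L) : Prop :=
  forall x : X, exists a : X, [set x' | u x <= u x'] = [set x' | a <= x'].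

(* [u] is total; only its restriction to [S] matters. *)
Definition efficient_points d d' (X : porderType d) (L : orderType d')
    (u : X -> L) (S : set X) : set X :=
  [set x | S x /\ forall x', S x' -> u x <= u x' -> x <= x'].

(* In the two definitions below, [dfwith x y] with [y : X k] is the profile
   (x_{-k}; y), i.e. [x] with its [k]-th coordinate replaced by [y]. *)
Definition nash_point n d d' (X : 'I_n -> porderType d) (L : orderType d')
    (u : 'I_n -> (forall j, X j) -> L) (S : forall j, set (X j))
    (x : forall j, X j) : Prop :=
  (forall j, S j (x j)) /\
  forall (k : 'I_n) (y : X k), S k y -> u k (dfwith x y) <= u k x.

Definition efficient_for n d d' (X : 'I_n -> porderType d) (L : orderType d')
    (u : 'I_n -> (forall j, X j) -> L) (S : forall j, set (X j))
    (x : forall j, X j) (i : 'I_n) : Prop :=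
  efficient_points (fun y : X i => u i (dfwith x y)) (S i) (x i).

(* Minima of nonempty finite families.  [L] need not have a top element, so
   the initial value of each iterated minimum is a member of the family: the
   term of index [k] for [payoff]; the term of index [ordS k], the cyclic
   successor of [k], for [payoff_others].  The latter satisfies [ordS k != k]
   as soon as [1 < n], so [payoff_others] does not depend on [x k]. *)
Definition payoff n d d' (X : 'I_n -> porderType d) (L : orderType d')
    (u : forall k j : 'I_n, X j -> L) (k : 'I_n) (x : forall j, X j) : L :=
  \big[Order.min/u k k (x k)]_(j < n) u k j (x j).

Definition payoff_others n d d' (X : 'I_n -> porderType d) (L : orderType d')
    (u : forall k j : 'I_n, X j -> L) (k : 'I_n) (x : forall j, X j) : L :=
  \big[Order.min/u k (ordS k) (x (ordS k))]_(j < n | j != k) u k j (x j).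

(* Main.v *)
Require Import Defs.
From mathcomp Require Import all_boot all_order.
From mathcomp Require Import classical_sets.

Set Implicit Arguments.
Unset Strict Implicit.
Unset Printing Implicit Defensive.

Import Order.TTheory.

Local Open Scope classical_set_scope.
Local Open Scope order_scope.

(** Fixing the strategies of the other players, the payoff of player [i] is
    [min (u_ii, t)] with the constant [t] at least [u_ii (x_i)].  Truncation at
    such a level does not change the upper level set of [u_ii] at [x_i], and
    efficiency depends on that level set only. *)

Lemma ordS_neq n (k : 'I_n) : (1 < n)%N -> ordS k != k.
Proof.
move=> n_gt1; rewrite -val_eqE /=.
have [lt_k1n|le_nk1] := ltnP k.+1 n; first by rewrite modn_small // gtn_eqF.
(* Here [k] is the last index: its successor wraps around to 0, while [k] is positive because
   [1 < n]. *)
have <- : n = k.+1 by apply/eqP; rewrite eqn_leq le_nk1 ltn_ord.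
rewrite modnn eq_sym -lt0n.
by rewrite -ltnS (leq_trans n_gt1).
Qed.

(** Each iterated minimum starts from a member of its family, so both sides are greatest lower
    bounds of the same values. *)
Lemma payoff_min n d d' (X : 'I_n -> porderType d) (L : orderType d')
    (u : forall k j : 'I_n, X j -> L) (k : 'I_n) (x : forall j, X j) :
  (1 < n)%N -> payoff u k x = Order.min (u k k (x k)) (payoff_others u k x).
Proof.
move=> n_gt1; apply/le_anti/andP; split.
- rewrite le_min bigmin_le_cond //=; apply/bigmin_geP.
  by split=> [|j _]; exact: bigmin_le_cond.
- apply/bigmin_geP; split=> [|j _]; first by rewrite ge_min lexx.
  rewrite ge_min; have [->|neq_jk] := eqVneq j k; first by rewrite lexx.
  by rewrite orbC [X in X || _]bigmin_le_cond.
Qed.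

Lemma payoff_others_dfwith n d d' (X : 'I_n -> porderType d)
    (L : orderType d') (u : forall k j : 'I_n, X j -> L) (k : 'I_n)
    (x : forall j, X j) (y : X k) :
  (1 < n)%N -> payoff_others u k (dfwith x y) = payoff_others u k x.
Proof.
(* The initial value, of index [ordS k], must also be unaffected by the change at [k]. *)
move=> n_gt1; rewrite /payoff_others dfwith_out; last first.
  by rewrite eq_sym ordS_neq.
by apply: eq_bigr => j neq_jk; rewrite dfwith_out // eq_sym.
Qed.

Lemma payoff_dfwith n d d' (X : 'I_n -> porderType d) (L : orderType d')
    (u : forall k j : 'I_n, X j -> L) (k : 'I_n) (x : forall j, X j)
    (y : X k) :
  (1 < n)%N ->
  payoff u k (dfwith x y) = Order.min (u k k y) (payoff_others u k x).
Proof. by move=> n_gt1; rewrite payoff_min // dfwith_in payoff_others_dfwith. Qed.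

Theorem mainTheorem5 (d d' : Order.disp_t) (L : orderType d')
    (n : nat) (hn : (2 <= n)%N)
    (X : 'I_n -> meetSemilatticeType d)
    (S : forall j : 'I_n, set (X j))
    (S_nonempty : forall j : 'I_n, S j !=set0)
    (S_comprehensive : forall j : 'I_n, comprehensive (S j))
    (S_bounded : forall j : 'I_n, has_ubound (S j))
    (u : forall k j : 'I_n, X j -> L)
    (u_quasi_leontief : forall k j : 'I_n, quasi_leontief (u k j))
    (i : 'I_n) (x : forall j : 'I_n, X j)
    (x_nash : nash_point (payoff u) S x)
    (hx : u i i (x i) <= payoff_others u i x) :
  (efficient_for (payoff u) S x i <-> efficient_points (u i i) (S i) (x i))
  /\ payoff u i x = u i i (x i).
Proof.
(* By [hx] the truncation level already reaches [u i i (x i)], so [u i i y] alone decides the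
   comparison. *)
have payoff_x y :
    (u i i (x i) <= payoff u i (dfwith x y)) = (u i i (x i) <= u i i y).
  by rewrite payoff_dfwith // le_min hx andbT.
(* Unfolding [efficient_for] at [x i] produces the profile [dfwith x (x i)] rather than [x]. *)
have payoff_xi : payoff u i (dfwith x (x i)) = u i i (x i).
  by rewrite payoff_dfwith // min_l.
split; last by rewrite payoff_min // min_l.
(* The two notions differ only in the premise comparing utilities, which the two facts above
   translate. *)
split=> -[Sxi eff]; split=> // y Sy le_y; apply: eff => //.
- by rewrite payoff_xi payoff_x.
- by rewrite -payoff_x -payoff_xi.
Qed.
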